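(* Let $M$ and $N$ be real $\mathcal{C}^{(k)}$-manifolds for some $k$, $0\leq k\leq\infty$. Let $T:(\mathcal{C}^{(k)}_c(M),+,\cdot)\rightarrow(\mathcal{C}^{(k)}_c(N),+,\cdot)$ be an isomorphism of algebras. Then there exists a $\mathcal{C}^{(k)}$-diffeomorphism $\psi:N\rightarrow M$ such that either $Tf=f\circ\psi$ for all $f\in\mathcal{C}^{(k)}_c(M)$, or $Tf=\overline{f\circ\psi}$ for all $f\in\mathcal{C}^{(k)}_c(M)$.
   Context: For a real $\mathcal{C}^{(k)}$-manifold $M$ (a manifold of differentiability class $\mathcal{C}^k$; for $k=0$ a topological manifold), $\mathcal{C}^{(k)}_c(M)$ denotes the set of all compactly supported complex-valued functions on $M$ of class $\mathcal{C}^k$, and $(\mathcal{C}^{(k)}_c(M),+,\cdot)$ denotes the algebra it forms under pointwise addition and pointwise multiplication. A $\mathcal{C}^{(k)}$-diffeomorphism is a bijection of class $\mathcal{C}^k$ with inverse of class $\mathcal{C}^k$ (a homeomorphism when $k=0$). The bar denotes pointwise complex conjugation.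
   Formalization: M is assumed connected and of positive dimension: for M=N=ℝ⊔ℝ, identity on one line and conjugation on the other is an isomorphism for + and · of neither form, and for M=N=point wild automorphisms of ℂ are counterexamples. *)

(* Defs.v *)
From HB Require Import structures.
From mathcomp Require Import all_boot all_order all_algebra.
From mathcomp Require Import complex.
From mathcomp Require Import all_classical all_reals all_analysis.

Set Implicit Arguments.
Unset Strict Implicit.
Unset Printing Implicit Defensive.

Import Order.TTheory GRing.Theory Num.Theory numFieldNormedType.Exports.

Local Open Scope classical_set_scope.
Local Open Scope ring_scope.

(* All partial derivatives of f of order at most k exist and are continuous on
   U; meant for open U, on which ['D_v f] depends only on the restriction of f
   to U. *)
Fixpoint Cn_on (R : realType) (m : nat) (V : normedModType R) (k : nat)
    (U : set 'rV[R]_m) (f : 'rV[R]_m -> V) {struct k} : Prop :=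
  (forall x, U x -> {for x, continuous f}) /\
  (if k is k'.+1 then
     forall i : 'I_m,
       (forall x, U x -> derivable f x (delta_mx 0 i)) /\
       Cn_on k' U ('D_(delta_mx 0 i) f)
   else True).

(* A differentiability class is an [option nat]: [Some k] is the finite class k,
   [None] is the class infinity. *)
Definition Ck_on (R : realType) (m : nat) (V : normedModType R)
    (k : option nat) (U : set 'rV[R]_m) (f : 'rV[R]_m -> V) : Prop :=
  if k is Some k' then Cn_on k' U f else forall n, Cn_on n U f.

(* A homeomorphism from an open set of M onto an open set of R^m. Both maps are
   total; their values outside [chart_dom] and [chart_im] are irrelevant. *)
Record chart (R : realType) (m : nat) (M : topologicalType) := Chart {
  chart_dom : set M;
  chart_map : M -> 'rV[R]_m;
  chart_inv : 'rV[R]_m -> M;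
  chart_dom_open : open chart_dom;
  chart_im_open : open (chart_map @` chart_dom);
  chart_mapK : forall x, chart_dom x -> chart_inv (chart_map x) = x;
  chart_map_continuous :
    forall x, chart_dom x -> {for x, continuous chart_map};
  chart_inv_continuous :
    forall u, (chart_map @` chart_dom) u -> {for u, continuous chart_inv}
}.

Definition chart_im (R : realType) (m : nat) (M : topologicalType)
    (c : chart R m M) : set 'rV[R]_m :=
  chart_map c @` chart_dom c.

(* The atlas need not be maximal: the C^k functions and maps below are the same
   for all atlases that are compatible with each other. *)
Record Ck_manifold (R : realType) (k : option nat) (m : nat) := CkManifold {
  manifold_space :> topologicalType;
  manifold_atlas : set (chart R m manifold_space);
  manifold_hausdorff : hausdorff_space manifold_space;
  manifold_second_countable : @second_countable manifold_space;
  manifold_cover :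
    forall x, exists2 c, manifold_atlas c & chart_dom c x;
  manifold_compatible :
    forall c d, manifold_atlas c -> manifold_atlas d ->
      Ck_on k (chart_map c @` (chart_dom c `&` chart_dom d))
        (chart_map d \o chart_inv c)
}.

Definition Ck_real_fun (R : realType) (k : option nat) (m : nat)
    (M : Ck_manifold R k m) (f : M -> R) : Prop :=
  forall c, manifold_atlas c ->
    Ck_on k (chart_im c) (f \o chart_inv c : 'rV[R]_m -> R^o).

(* The carrier of the algebra of compactly supported complex-valued C^k
   functions. The real and imaginary parts are used because [R[i]] has no
   normed space structure over [R] in the libraries. *)
Definition Cck (R : realType) (k : option nat) (m : nat)
    (M : Ck_manifold R k m) : set (M -> R[i]) :=
  [set f | [/\ Ck_real_fun (fun x => complex.Re (f x)),
               Ck_real_fun (fun x => complex.Im (f x)) &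
               compact (closure [set x | f x != 0])]].
Arguments Cck {R k m} M.

(* Additive and multiplicative, but not assumed to be linear over the complex
   numbers. Only the values of T on [Cck M] matter. *)
Definition Cck_isomorphism (R : realType) (k : option nat) (m n : nat)
    (M : Ck_manifold R k m) (N : Ck_manifold R k n)
    (T : (M -> R[i]) -> (N -> R[i])) : Prop :=
  [/\ set_bij (Cck M) (Cck N) T,
      forall f g, Cck M f -> Cck M g ->
        T (fun x => f x + g x) = (fun y => T f y + T g y) &
      forall f g, Cck M f -> Cck M g ->
        T (fun x => f x * g x) = (fun y => T f y * T g y)].

Definition Ck_map (R : realType) (k : option nat) (m n : nat)
    (M : Ck_manifold R k m) (N : Ck_manifold R k n) (g : M -> N) : Prop :=
  continuous g /\
  forall (c : chart R m M) (d : chart R n N),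
    manifold_atlas c -> manifold_atlas d ->
    Ck_on k (chart_map c @` (chart_dom c `&` g @^-1` chart_dom d))
      (chart_map d \o g \o chart_inv c).

Definition Ck_diffeomorphism (R : realType) (k : option nat) (m n : nat)
    (M : Ck_manifold R k m) (N : Ck_manifold R k n) (g : M -> N) : Prop :=
  Ck_map g /\
  exists h : N -> M, [/\ cancel g h, cancel h g & Ck_map h].

(* Main.v *)
(* For y in N the map f |-> T f y is a ring homomorphism onto the complex
   numbers; by compactness of supports its kernel is the set of functions
   vanishing at a point psi y, so T f y = tau_y (f (psi y)) for a field
   automorphism tau_y. Bump functions show that psi is a homeomorphism. Field
   automorphisms fix the rationals, and a function with non-constant real
   values near psi y takes rational values on a set accumulating at psi y;
   continuity of T f forces tau_y to fix the reals, so tau_y is the identity or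
   the conjugation. Which of the two is locally constant in y, hence constant.
   Pulling back bump functions times coordinates shows that psi and its inverse
   are of class C^k. *)
Require Import Defs.
From HB Require Import structures.
From mathcomp Require Import all_boot all_order all_algebra.
From mathcomp Require Import complex.
From mathcomp Require Import all_classical all_reals all_analysis.
From mathcomp Require Import ring lra.

Set Implicit Arguments.
Unset Strict Implicit.
Unset Printing Implicit Defensive.

Import Order.TTheory GRing.Theory Num.Theory numFieldNormedType.Exports.

Local Open Scope classical_set_scope.
Local Open Scope ring_scope.

(** * General topology: locality of continuity and compactness of closures *)

Lemma near_eq_continuous (T S : topologicalType) (f g : T -> S) (x : T) :
  (\near x, f x = g x) -> {for x, continuous f} -> {for x, continuous g}.
Proof.
move=> fg fc; have e : f x = g x := nbhs_singleton fg.
have {}fc : f @ x --> g x by rewrite -e.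
exact: cvg_trans (near_eq_cvg _) fc.
Qed.

Lemma neq0_near (R : realType) (T : topologicalType) (f : T -> R) (x : T) :
  {for x, continuous f} -> f x != 0 -> \near x, f x != 0.
Proof.
move=> fc fx; apply: (fc [set y | y != 0]).
by apply: open_nbhs_nbhs; split => //; exact: open_neq.
Qed.

Lemma compact_closure_sub (T : topologicalType) (A B : set T) :
  closed B -> compact B -> A `<=` B -> compact (closure A).
Proof.
move=> cB kB AB; apply: subclosed_compact kB _; first exact: closed_closure.
by rewrite closureE; exact: smallest_sub.
Qed.

(** * Functions of class C^k on open subsets of R^m *)

Section DifferentiabilityClasses.
Context {R : realType} {m : nat}.
Implicit Types (V : normedModType R) (U : set 'rV[R]_m) (k : nat) (K : option nat).

Lemma Cn_on_continuous V k U (f : 'rV[R]_m -> V) :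
  Cn_on k U f -> forall x, U x -> {for x, continuous f}.
Proof. by case: k => [|k] []. Qed.

Lemma Cn_on_near V k U (f g : 'rV[R]_m -> V) :
  (forall x, U x -> \near x, f x = g x) -> Cn_on k U f -> Cn_on k U g.
Proof.
elim: k U f g => [|k IHk] U f g fg [fc fD]; split.
- by move=> x Ux; exact: near_eq_continuous (fg x Ux) (fc x Ux).
- by [].
- by move=> x Ux; exact: near_eq_continuous (fg x Ux) (fc x Ux).
- move=> i; have [fd fk] := fD i; split.
    by move=> x Ux; apply: near_eq_derivable (fg x Ux) (fd x Ux).
  apply: IHk fk => x Ux.
  (* Equality near [x] is also equality near every point close to [x], so the derivatives agree on a
     whole neighbourhood, as the induction hypothesis requires. *)
  by have /nbhs_interior := fg x Ux; apply: filterS => y; exact: near_eq_derive.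
Qed.

Lemma Cn_on_eq_open V k U (f g : 'rV[R]_m -> V) : open U ->
  (forall x, U x -> f x = g x) -> Cn_on k U f -> Cn_on k U g.
Proof.
move=> oU fg; apply: Cn_on_near => x Ux.
by apply: filterS fg _; exact: open_nbhs_nbhs.
Qed.

(** [Cn_on k W f] is a conjunction of conditions on the total function [f] at the single points of
    [W], so any sets [W] covering [U] will do. *)
Lemma Cn_on_local V k U (f : 'rV[R]_m -> V) :
  (forall x, U x -> exists2 W, W x & Cn_on k W f) -> Cn_on k U f.
Proof.
elim: k f => [|k IHk] f Uf; split=> //.
- by move=> x /Uf[W Wx]; move/Cn_on_continuous; apply.
- by move=> x /Uf[W Wx]; move/Cn_on_continuous; apply.
- move=> i; split; first by move=> x /Uf[W Wx [_ /(_ i)[+ _]]]; apply.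
  by apply: IHk => x /Uf[W Wx [_ /(_ i)[_ ?]]]; exists W.
Qed.

Lemma Cn_on_leS V k U (f : 'rV[R]_m -> V) : Cn_on k.+1 U f -> Cn_on k U f.
Proof.
elim: k f => [|k IHk] f [fc fD]; split=> // i.
by have [fd /IHk] := fD i.
Qed.

Lemma Cn_on_cst V k U (a : V) : Cn_on k U (fun=> a).
Proof.
elim: k a => [|k IHk] a; split=> //.
- by move=> x _; exact: cst_continuous.
- by move=> x _; exact: cst_continuous.
- move=> i; split; first by move=> x _; exact: derivable_cst.
  rewrite (_ : 'D_ _ _ = fun=> 0); first exact: IHk.
  by apply/funext => x; exact: derive_cst.
Qed.

Lemma Cn_onD V k U (f g : 'rV[R]_m -> V) : open U ->
  Cn_on k U f -> Cn_on k U g -> Cn_on k U (fun x => f x + g x).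
Proof.
move=> oU; elim: k f g => [|k IHk] f g [fc fD] [gc gD]; split=> //.
- by move=> x Ux; apply: continuousD; [exact: fc|exact: gc].
- by move=> x Ux; apply: continuousD; [exact: fc|exact: gc].
- move=> i; have [fd fk] := fD i; have [gd gk] := gD i; split.
    by move=> x Ux; apply: derivableD; [exact: fd|exact: gd].
  apply: Cn_on_eq_open (IHk _ _ fk gk) => // x Ux.
  by rewrite deriveD //; [apply: fd|apply: gd].
Qed.

Lemma Cn_onM k U (f g : 'rV[R]_m -> R^o) : open U ->
  Cn_on k U f -> Cn_on k U g -> Cn_on k U (fun x => f x * g x : R^o).
Proof.
move=> oU; elim: k f g => [|k IHk] f g Cf Cg;
  have [fc fD] := Cf; have [gc gD] := Cg; split=> //.
- by move=> x Ux; apply: continuousM; [exact: fc|exact: gc].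
- by move=> x Ux; apply: continuousM; [exact: fc|exact: gc].
- move=> i; have [fd fk] := fD i; have [gd gk] := gD i; split.
    by move=> x Ux; apply: derivableM; [exact: fd|exact: gd].
  apply: (@Cn_on_eq_open _ _ _ (fun y =>
     f y * 'D_(delta_mx 0 i) g y + g y * 'D_(delta_mx 0 i) f y : R^o)) => //.
    by move=> x Ux; rewrite deriveM //; [apply: fd|apply: gd].
  by apply: Cn_onD => //; apply: IHk => //; exact: Cn_on_leS.
Qed.

Lemma Cn_onV k U (f : 'rV[R]_m -> R^o) : open U ->
  (forall x, U x -> f x != 0) -> Cn_on k U f -> Cn_on k U (fun x => (f x)^-1 : R^o).
Proof.
move=> oU f0; elim: k => [|k IHk] Cf; have [fc fD] := Cf; split=> //.
- by move=> x Ux; apply: continuousV; [exact: f0|exact: fc].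
- by move=> x Ux; apply: continuousV; [exact: f0|exact: fc].
- move=> i; have [fd fk] := fD i; split.
    by move=> x Ux; apply: derivableV; [exact: f0|exact: fd].
  have IH := IHk (Cn_on_leS Cf).
  (* The square is written out as a product of two inverses, each of class [k] by the induction
     hypothesis, so that [Cn_onM] applies. *)
  apply: (@Cn_on_eq_open _ _ _ (fun y =>
     (-1) * (((f y)^-1 * (f y)^-1) * 'D_(delta_mx 0 i) f y) : R^o)) => //.
    move=> x Ux; rewrite deriveV ?f0 //; last exact: fd.
    by rewrite -expr2 exprVn mulN1r scaleNr.
  by do ?[apply: Cn_onM => //]; exact: Cn_on_cst.
Qed.

Lemma Ck_on_continuous V K U (f : 'rV[R]_m -> V) :
  Ck_on K U f -> forall x, U x -> {for x, continuous f}.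
Proof. by case: K => [k|/(_ 0%N)]; exact: Cn_on_continuous. Qed.

Lemma Ck_on_near V K U (f g : 'rV[R]_m -> V) :
  (forall x, U x -> \near x, f x = g x) -> Ck_on K U f -> Ck_on K U g.
Proof. by case: K => [k|] fg /=; [|move=> + n => /(_ n)]; exact: Cn_on_near. Qed.

Lemma Ck_on_local V K U (f : 'rV[R]_m -> V) :
  (forall x, U x -> exists2 W, W x & Ck_on K W f) -> Ck_on K U f.
Proof.
case: K => [k|] Uf /=; [|move=> n]; apply: Cn_on_local => x /Uf[W] ? Wf;
  by exists W.
Qed.

Lemma Ck_on_cst V K U (a : V) : Ck_on K U (fun=> a).
Proof. by case: K => [k|n]; exact: Cn_on_cst. Qed.

Lemma Ck_onD V K U (f g : 'rV[R]_m -> V) : open U ->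
  Ck_on K U f -> Ck_on K U g -> Ck_on K U (fun x => f x + g x).
Proof.
by case: K => [k|] oU /=; [|move=> Uf Ug n]; apply: Cn_onD.
Qed.

Lemma Ck_onM K U (f g : 'rV[R]_m -> R^o) : open U ->
  Ck_on K U f -> Ck_on K U g -> Ck_on K U (fun x => f x * g x : R^o).
Proof.
by case: K => [k|] oU /=; [|move=> Uf Ug n]; apply: Cn_onM.
Qed.

Lemma Ck_onV K U (f : 'rV[R]_m -> R^o) : open U ->
  (forall x, U x -> f x != 0) -> Ck_on K U f -> Ck_on K U (fun x => (f x)^-1 : R^o).
Proof.
by case: K => [k|] oU f0 /=; [|move=> Uf n]; apply: Cn_onV.
Qed.

Lemma Ck_on_sum K U (I : Type) (r : seq I) (F : I -> 'rV[R]_m -> R^o) : open U ->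
  (forall i, Ck_on K U (F i)) -> Ck_on K U (fun x => \sum_(i <- r) F i x : R^o).
Proof.
move=> oU CF; elim: r => [|i r IHr].
  rewrite (_ : (fun _ => _) = fun=> 0); first exact: Ck_on_cst.
  by apply/funext => x; rewrite big_nil.
rewrite (_ : (fun _ => _) = fun x => F i x + \sum_(j <- r) F j x).
  exact: Ck_onD.
by apply/funext => x; rewrite big_cons.
Qed.

Lemma cvg_rV (T : Type) (F : set_system T) (l : nat) (f : T -> 'rV[R]_l) (a : 'rV[R]_l) :
  Filter F -> (forall j, f x 0 j @[x --> F] --> a 0 j) -> f @ F --> a.
Proof.
move=> FF fa A [B aB BA].
(* A neighbourhood of a matrix contains a product of neighbourhoods of its finitely many entries. *)
have FB : \forall x \near F, forall i j, B i j (f x i j).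
  apply: filter_forall => i; apply: filter_forall => j.
  by rewrite (ord1 i); exact: fa.
by apply: filterS FB => x; exact: BA.
Qed.

(** Reduces chart-valued maps to scalar functions, for which products and inverses make sense. *)
Lemma Cn_on_rV k U (l : nat) (f : 'rV[R]_m -> 'rV[R]_l) : open U ->
  Cn_on k U f <-> forall j, Cn_on k U (fun x => f x 0 j : R^o).
Proof.
move=> oU.
have cont (g : 'rV[R]_m -> 'rV[R]_l) x :
    {for x, continuous g} <-> forall j, {for x, continuous (fun y => g y 0 j)}.
  split=> [gc j|gc]; last by apply: (@cvg_rV _ (nbhs x) _ g (g x)) => j; exact: gc.
  by apply: (@continuous_comp _ _ _ g (fun N : 'rV[R]_l => N 0 j)) => //;
    exact: coord_continuous.
elim: k f => [|k IHk] f.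
  split=> [[fc _] j|fc]; split=> // x Ux.
    by have /cont := fc x Ux; apply.
  by apply/cont => j; have [+ _] := fc j; apply.
have coordD x i : derivable f x (delta_mx 0 i) ->
    forall j, 'D_(delta_mx 0 i) f x 0 j = 'D_(delta_mx 0 i) (fun y => f y 0 j : R^o) x.
  by move=> fd j; rewrite derive_mx // mxE.
split.
  move=> [fc fD] j; split; first by move=> x Ux; have /cont := fc x Ux; apply.
  move=> i; have [fd fk] := fD i; split.
    by move=> x Ux; have /derivable_mxP := fd x Ux; apply.
  have /IHk/(_ j) := fk; apply: Cn_on_eq_open => // x Ux; exact/coordD/fd.
move=> fj; split; first by move=> x Ux; apply/cont => j; have [+ _] := fj j; apply.
have fd i x : U x -> derivable f x (delta_mx 0 i).
  move=> Ux; apply/derivable_mxP => i' j; rewrite ord1.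
  by have [_ /(_ i)[+ _]] := fj j; apply.
move=> i; split; first exact: fd.
apply/IHk => j; have [_ /(_ i)[_]] := fj j.
by apply: Cn_on_eq_open => // x Ux; rewrite -coordD //; exact: fd.
Qed.

Lemma Ck_on_rV K U (l : nat) (f : 'rV[R]_m -> 'rV[R]_l) : open U ->
  Ck_on K U f <-> forall j, Ck_on K U (fun x => f x 0 j : R^o).
Proof.
move=> oU; case: K => [k|] /=; first exact: Cn_on_rV.
split=> C; first by move=> j n; have /(Cn_on_rV _ _ oU) := C n; apply.
by move=> n; apply/(Cn_on_rV _ _ oU) => j; exact: C.
Qed.

End DifferentiabilityClasses.

(** * Flat functions *)

Section FlatFunctions.
Context {R : realType}.

(* The linear span of these functions is closed under derivation:
   [flat p]' = [flat p.+2] - p [flat p.+1]. *)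
Definition flat (p : nat) (t : R) : R :=
  if 0 < t then t ^- p * expR (- t^-1) else 0.

Lemma flat_gt0 p t : 0 < t -> 0 < flat p t.
Proof. by move=> t0; rewrite /flat t0 mulr_gt0 ?expR_gt0 // invr_gt0 exprn_gt0. Qed.

Lemma flat_le0 p t : t <= 0 -> flat p t = 0.
Proof. by rewrite /flat; case: ltP. Qed.

(** Comes from [exp s >= s^(p+1) / (p+1)!] at [s = 1/t]. It is the only estimate needed at the
    origin. *)
Lemma flat_norm_le p t : `|flat p t| <= (p.+1)`!%:R * `|t|.
Proof.
have [t0|t0] := ltP 0 t; last by rewrite flat_le0 // normr0 mulr_ge0.
rewrite (gtr0_norm (flat_gt0 p t0)) gtr0_norm // /flat t0 expRN.
have H := @expR_ge1Dxn R t^-1 p (ltW (_ : 0 < t^-1)).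
rewrite ler_pdivrMr ?expR_gt0 //.
rewrite -ler_pdivrMl; last by rewrite mulr_gt0 // ltr0n fact_gt0.
apply: le_trans (H _); last by rewrite invr_gt0.
rewrite (_ : _ * _ = t^-1 ^+ p.+1 / (p.+1)`!%:R); first by rewrite lerDr.
by rewrite exprVn exprS !invfM; ring.
Qed.

(** The difference quotient of [flat p] at 0 is again a flat function, so its limit is known. *)
Lemma flat_quotient p t : t^-1 * flat p t = flat p.+1 t.
Proof.
by rewrite /flat; case: ltP => t0; rewrite ?mulr0 // exprS invfM mulrA.
Qed.

Lemma flat_cvg0 p : flat p t @[t --> (0 : R)] --> (0 : R).
Proof.
apply/cvgr0Pnorm_le => e e0.
near=> t; apply: le_trans (flat_norm_le p t) _.
rewrite -ler_pdivlMl ?ltr0n ?fact_gt0 //.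
near: t; apply: (@cvgr0_norm_le _ _ _ _ _ id) => //.
by rewrite mulr_gt0 // invr_gt0 ltr0n fact_gt0.
Unshelve. all: by end_near. Qed.

Lemma is_derive_flat p (t : R) :
  is_derive t (1 : R) (flat p) (flat p.+2 t - p%:R * flat p.+1 t).
Proof.
have [t0|t0|<-] := ltgtP 0 t.
- apply: (@near_eq_is_derive R R R (fun s : R => s ^- p * expR (- s^-1))).
    near=> s; rewrite /flat ifT //; near: s; exact: lt_nbhsr.
  have t_neq0 : t != 0 by rewrite gt_eqF.
  pose iv (s : R) : R := s^-1.
  have Div : is_derive t (1 : R) iv (- t ^- 2 *: (1 : R)).
    exact: (is_deriveV (f := id)).
  have := is_deriveM (is_deriveX p Div)
    (is_derive1_comp (is_derive_expR _) (is_deriveN Div)).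
  rewrite (_ : _ * _ = fun s => s ^- p * expR (- s^-1)); last first.
    by apply/funext => s; rewrite !fctE exprVn.
  move=> D; apply: is_derive_eq D _.
  rewrite /flat t0 !fctE /iv /=.
  rewrite /GRing.scale /= -!exprVn; set u := t^-1; set e := expR (- u).
  by case: p => [|p]; rewrite /= ?exprS; ring.
- apply: (@near_eq_is_derive R R R (cst 0)).
    near=> s; rewrite flat_le0 // ltW //; near: s; exact: lt_nbhsl.
  by rewrite !flat_le0 ?ltW // mulr0 subr0; exact: is_derive_cst.
- rewrite !flat_le0 // mulr0 subr0.
  have D : (fun h : R => h^-1 *: ((flat p \o shift 0) (h *: (1:R)) - flat p 0)) @ 0^' --> (0:R).
    rewrite (_ : (fun h => _) = flat p.+1).
      by apply: cvg_trans (flat_cvg0 p.+1); apply: cvg_app; exact: cvg_within.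
    by apply/funext => h /=; rewrite (flat_le0 p (lexx 0)) addr0 subr0 [h *: 1]mulr1 -flat_quotient.
  apply: DeriveDef; first by apply/cvg_ex; exists 0.
  exact: cvg_lim D.
Unshelve. all: by end_near. Qed.

Lemma flat_continuous p : continuous (flat p : R -> R).
Proof.
move=> t; have [d _] := is_derive_flat p t.
by apply: differentiable_continuous; exact/derivable1_diffP.
Qed.

(** Since [f] is only derivable along [v], the chain rule is applied on the line [t *: v + x], where
    it is the one-variable rule. *)
Lemma is_derive_comp_real (V : normedModType R) (f : V -> R^o) (g : R -> R) (x v : V) (a b : R) :
  is_derive (f x) 1 g a -> is_derive x v f b ->
  is_derive x v (fun y => g (f y) : R^o) (a * b).
Proof.
have line (h : V -> R^o) c : is_derive x v h c <->
    is_derive (0 : R) (1 : R) (fun t : R => h (t *: v + x)) c.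
  have E : 'D_v h x = 'D_1 (fun t : R => h (t *: v + x)) 0.
    rewrite /derive.
    set F := (X in lim (X @ _)); set G := (X in _ = lim (X @ _)).
    suff -> : F = G by [].
    apply/funext => t; rewrite /F /G /=.
    by rewrite addr0 scale0r add0r [t *: (1 : R)]mulr1.
  split=> -[d <-]; (apply: DeriveDef; last by rewrite E).
    exact: (derivable1P _ _ _).1 d.
  exact: (derivable1P _ _ _).2 d.
move=> Dg /line Df; apply: (proj2 (line (fun y => g (f y)) _)).
apply: (@is_derive1_comp R g (fun t => f (t *: v + x)) 0 a b) => //.
by rewrite scale0r add0r.
Qed.

Lemma Cn_on_flat m k U p (f : 'rV[R]_m -> R^o) : open U ->
  Cn_on k U f -> Cn_on k U (fun x => flat p (f x) : R^o).
Proof.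
(* The induction generalises [p], because the derivative of [flat p] involves [flat p.+1] and
   [flat p.+2]. *)
move=> oU; elim: k p => [|k IHk] p Cf; have [fc fD] := Cf.
  by split=> // x Ux; apply: continuous_comp; [exact: fc|exact: flat_continuous].
split; first by move=> x Ux; apply: continuous_comp; [exact: fc|exact: flat_continuous].
have Df i x : U x -> is_derive x (delta_mx 0 i) (fun y => flat p (f y) : R^o)
    ((flat p.+2 (f x) - p%:R * flat p.+1 (f x)) * 'D_(delta_mx 0 i) f x).
  move=> Ux; have [+ _] := fD i => /(_ x Ux)/derivableP.
  by apply: is_derive_comp_real; exact: is_derive_flat.
move=> i; split; first by move=> x Ux; have [] := Df i x Ux.
apply: (@Cn_on_eq_open _ _ _ _ _
  (fun x => (flat p.+2 (f x) + (- p%:R) * flat p.+1 (f x)) * 'D_(delta_mx 0 i) f x : R^o)) => //.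
  by move=> x Ux; have [_ ->] := Df i x Ux; rewrite mulNr.
have Ckf := Cn_on_leS Cf.
apply: Cn_onM => //; last by have [] := fD i.
apply: Cn_onD => //; first exact: IHk.
apply: Cn_onM => //; [exact: Cn_on_cst|exact: IHk].
Qed.

Lemma Ck_on_flat m K U p (f : 'rV[R]_m -> R^o) : open U ->
  Ck_on K U f -> Ck_on K U (fun x => flat p (f x) : R^o).
Proof. by case: K => [k|] oU /=; [|move=> Uf n]; apply: Cn_on_flat. Qed.

End FlatFunctions.

(** * Functions of class C^k on manifolds *)

Section Charts.
Context {R : realType} {m : nat} {M : topologicalType}.
Implicit Types (c : chart R m M).

Lemma chart_invK c u : chart_im c u -> chart_map c (chart_inv c u) = u.
Proof. by move=> [x cx <-]; rewrite chart_mapK. Qed.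

Lemma chart_inv_dom c u : chart_im c u -> chart_dom c (chart_inv c u).
Proof. by move=> [x cx <-]; rewrite chart_mapK. Qed.

(** As a preimage under [chart_inv], the image of an open set is seen to be open by continuity of
    the inverse chart. *)
Lemma image_chart_domI c (O : set M) :
  chart_map c @` (chart_dom c `&` O) = chart_im c `&` chart_inv c @^-1` O.
Proof.
apply/seteqP; split=> [_ [x [cx Ox] <-]|u [cu Ou]].
  by split; [exists x|rewrite /= chart_mapK].
by exists (chart_inv c u); [split=> //; exact: chart_inv_dom|exact: chart_invK].
Qed.

Lemma open_image_chart c (O : set M) : open O -> open (chart_map c @` (chart_dom c `&` O)).
Proof.
move=> oO; rewrite openE => u; rewrite image_chart_domI => -[cu Ou].
apply: filterI; first by apply: open_nbhs_nbhs; split=> //; exact: chart_im_open.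
by apply: chart_inv_continuous => //; exact: open_nbhs_nbhs.
Qed.

End Charts.

(** * Real functions of class C^k on open subsets of a manifold, and bump functions *)

Section CkFunctions.
Context {R : realType} {k : option nat} {m : nat} {M : Ck_manifold R k m}.
Implicit Types (O W K : set M) (f g : M -> R).

Definition Ck_fun_on O f : Prop := forall c, manifold_atlas c ->
  Ck_on k (chart_map c @` (chart_dom c `&` O)) (f \o chart_inv c : 'rV[R]_m -> R^o).

Lemma Ck_fun_onT f : Ck_fun_on setT f <-> Ck_real_fun f.
Proof.
split=> + c cM => /(_ c cM); rewrite /chart_im; by rewrite setIT.
Qed.

Lemma Ck_fun_on_local O f :
  (forall x, O x -> exists2 W, W x & Ck_fun_on W f) -> Ck_fun_on O f.
Proof.
move=> Of c cM; apply: Ck_on_local => _ [x [cx /Of[W Wx Wf]] <-].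
by exists (chart_map c @` (chart_dom c `&` W)); [exists x|exact: Wf].
Qed.

Lemma Ck_fun_on_sub O W f : O `<=` W -> Ck_fun_on W f -> Ck_fun_on O f.
Proof. by move=> OW Wf; apply: Ck_fun_on_local => x /OW ?; exists W. Qed.

Lemma Ck_fun_on_eq O f g : open O -> (forall x, O x -> f x = g x) ->
  Ck_fun_on O f -> Ck_fun_on O g.
Proof.
move=> oO fg Of c cM; apply: Ck_on_near (Of c cM) => u cOu.
suff : \forall v \near u, (chart_im c `&` chart_inv c @^-1` O) v.
  by apply: filterS => v [_ Ov] /=; exact: fg.
by rewrite -image_chart_domI; apply: open_nbhs_nbhs; split=> //; exact: open_image_chart.
Qed.

Lemma Ck_fun_on_continuous O f : open O -> Ck_fun_on O f ->
  forall x, O x -> {for x, continuous f}.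
Proof.
move=> oO Of x Ox; have [c cM cx] := manifold_cover x.
have C : {for chart_map c x, continuous (f \o chart_inv c)}.
  by apply: (Ck_on_continuous (Of c cM)); exists x.
apply: (@near_eq_continuous _ _ ((f \o chart_inv c) \o chart_map c)).
  have : nbhs x (chart_dom c) by apply: open_nbhs_nbhs; split=> //; exact: chart_dom_open.
  by apply: filterS => y cy; rewrite /= chart_mapK.
by apply: continuous_comp => //; exact: chart_map_continuous.
Qed.

Lemma Ck_fun_on_cst O (a : R) : Ck_fun_on O (fun=> a).
Proof. by move=> c _; exact: Ck_on_cst. Qed.

Lemma Ck_fun_onD O f g : open O -> Ck_fun_on O f -> Ck_fun_on O g ->
  Ck_fun_on O (fun x => f x + g x).
Proof.
move=> oO Of Og c cM; apply: (@Ck_onD _ _ _ _ _ (f \o _) (g \o _)).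
- exact: open_image_chart.
- exact: Of.
- exact: Og.
Qed.

Lemma Ck_fun_onM O f g : open O -> Ck_fun_on O f -> Ck_fun_on O g ->
  Ck_fun_on O (fun x => f x * g x).
Proof.
move=> oO Of Og c cM; apply: (@Ck_onM _ _ _ _ (f \o _) (g \o _)).
- exact: open_image_chart.
- exact: Of.
- exact: Og.
Qed.

Lemma Ck_fun_onN O f : open O -> Ck_fun_on O f -> Ck_fun_on O (fun x => - f x).
Proof.
move=> oO Of; rewrite (_ : (fun _ => _) = fun x => (-1) * f x).
  by apply: Ck_fun_onM => //; exact: Ck_fun_on_cst.
by apply/funext => x; rewrite mulN1r.
Qed.

Lemma Ck_fun_onV O f : open O -> (forall x, O x -> f x != 0) ->
  Ck_fun_on O f -> Ck_fun_on O (fun x => (f x)^-1).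
Proof.
move=> oO f0 Of c cM; apply: (@Ck_onV _ _ _ _ (f \o _)).
- exact: open_image_chart.
- by move=> u; rewrite image_chart_domI => -[_ /f0].
- exact: Of.
Qed.

Lemma Ck_fun_on_flat O p f : open O ->
  Ck_fun_on O f -> Ck_fun_on O (fun x => flat p (f x)).
Proof.
move=> oO Of c cM; apply: (@Ck_on_flat _ _ _ _ _ (f \o _)).
- exact: open_image_chart.
- exact: Of.
Qed.

Lemma Ck_fun_on_sum O (I : Type) (r : seq I) (F : I -> M -> R) : open O ->
  (forall i, Ck_fun_on O (F i)) -> Ck_fun_on O (fun x => \sum_(i <- r) F i x).
Proof.
move=> oO OF c cM; apply: (@Ck_on_sum _ _ _ _ _ _ (fun i => F i \o _)).
- exact: open_image_chart.
- by move=> i; exact: OF.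
Qed.

Lemma Ck_fun_on_coord (d : chart R m M) j : manifold_atlas d ->
  Ck_fun_on (chart_dom d) (fun x => chart_map d x 0 j).
Proof.
move=> dM c cM.
have oI := @open_image_chart _ _ _ c _ (chart_dom_open d).
by have /(Ck_on_rV _ _ oI)/(_ j) := manifold_compatible cM dM.
Qed.

Lemma Ck_fun_on_extend0 O K f : open O -> closed K -> K `<=` O ->
  (forall x, ~ K x -> f x = 0) -> Ck_fun_on O f -> Ck_real_fun f.
Proof.
move=> oO cK KO f0 Of; apply/Ck_fun_onT/Ck_fun_on_local => x _.
have [Kx|nKx] := pselect (K x); first by exists O => //; exact: KO.
exists (~` K) => //; apply: (@Ck_fun_on_eq _ (fun=> 0)).
- exact: closed_openC.
- by move=> y /f0.
- exact: Ck_fun_on_cst.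
Qed.

(** In the chart the function is [flat 0 (e^2 - |u - a|^2)], extended by zero. Its support lies in
    the preimage of a compact cube, which is closed because the manifold is Hausdorff. *)
Lemma Ck_bump (d : chart R m M) x O : manifold_atlas d -> chart_dom d x ->
  open O -> O x -> exists chi : M -> R,
    [/\ Ck_real_fun chi, 0 < chi x, compact (closure [set y | chi y != 0]) &
        closure [set y | chi y != 0] `<=` chart_dom d `&` O].
Proof.
move=> dM dx oO Ox; set a := chart_map d x.
have /nbhs_ballP[r /= r0 rO] : nbhs a (chart_map d @` (chart_dom d `&` O)).
  by apply: open_nbhs_nbhs; split; [exact: open_image_chart|exists x].
(* Half the radius keeps the closed cube [B] inside the open ball of the sup norm. *)
set e := r / 2.
have e0 : 0 < e by rewrite divr_gt0.
set B := [set u : 'rV[R]_m | forall i, `[a 0 i - e, a 0 i + e]%classic (u 0 i)].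
have BO : B `<=` chart_map d @` (chart_dom d `&` O).
  move=> u Bu; apply: rO; split=> // i j; rewrite (ord1 i) /ball /= ltr_distlC.
  by have := Bu j; rewrite /= in_itv /=; move: r0 e0; rewrite /e; lra.
have kB : compact B.
  apply: (@rV_compact R m (fun i => `[a 0 i - e, a 0 i + e]%classic)) => i.
  exact: segment_compact.
set K := chart_inv d @` B.
have kK : compact K.
  apply: continuous_compact => //; apply: continuous_in_subspaceT => u.
  rewrite inE => /BO [y [dy _] <-]; apply: chart_inv_continuous.
  by exists y.
have cK : closed K by apply: compact_closed kK; exact: manifold_hausdorff.
have KO : K `<=` chart_dom d `&` O.
  by move=> _ [_ /BO[y [dy Oy] <-] <-]; rewrite chart_mapK.
pose q y := \sum_(i < m) (chart_map d y 0 i - a 0 i) ^+ 2.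
pose chi y := if y \in chart_dom d then flat 0 (e ^+ 2 - q y) else 0.
have chi0 y : ~ K y -> chi y = 0.
  move=> nKy; rewrite /chi; case: ifPn => // /set_mem dy.
  apply: flat_le0; rewrite leNgt; apply/negP => qe; apply: nKy.
  exists (chart_map d y); last exact: chart_mapK.
  move=> i; rewrite /= in_itv /=.
  (* The Euclidean ball of radius [e] lies in the cube: one square is at most the sum
     [q y < e^2]. *)
  have : (chart_map d y 0 i - a 0 i) ^+ 2 <= q y.
    by rewrite /q (bigD1 i) //= lerDl sumr_ge0 // => j _; exact: sqr_ge0.
  by move: qe e0; nra.
have chiK : [set y | chi y != 0] `<=` K.
  by move=> y /=; apply: contraPP => /chi0 ->; rewrite eqxx.
exists chi; split.
- apply: (@Ck_fun_on_extend0 (chart_dom d) K) => //; first exact: chart_dom_open.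
    by move=> y /KO[].
  have od := chart_dom_open d.
  apply: (@Ck_fun_on_eq _ (fun y => flat 0 (e ^+ 2 + - q y))) => //.
    by move=> y dy; rewrite /chi mem_set.
  apply: Ck_fun_on_flat => //; apply: Ck_fun_onD => //; first exact: Ck_fun_on_cst.
  apply: Ck_fun_onN => //; apply: Ck_fun_on_sum => // i.
  apply: Ck_fun_onM => //.
    by apply: Ck_fun_onD => //; [exact: Ck_fun_on_coord|exact: Ck_fun_on_cst].
  by apply: Ck_fun_onD => //; [exact: Ck_fun_on_coord|exact: Ck_fun_on_cst].
- rewrite /chi mem_set //; apply: flat_gt0.
  by rewrite /q big1 ?subr0 ?exprn_gt0 // => i _; rewrite subrr expr0n.
- exact: compact_closure_sub chiK.
- apply: subset_trans KO; rewrite closureE; exact: smallest_sub.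
Qed.

End CkFunctions.

(** * The algebra of compactly supported functions *)

Section CompactDirected.
Context {R : realType} {T : topologicalType}.

(* The sets on which the members of H vanish inside K form a filter base: a
   cluster point of it would be a common zero. *)
Lemma compact_directed_gt0 (K : set T) (H : set (T -> R)) :
  compact K -> H !=set0 ->
  (forall h, H h -> continuous h /\ forall x, 0 <= h x) ->
  (forall h h', H h -> H h' -> H (fun x => h x + h' x)) ->
  (forall x, K x -> exists2 h, H h & 0 < h x) ->
  exists2 h, H h & forall x, K x -> 0 < h x.
Proof.
move=> kK H0 Hc HD Hpos; apply: contrapT => nH.
pose B (h : T -> R) := K `&` [set x | h x = 0].
have FF : ProperFilter (filter_from H B).
  apply: filter_from_proper.
    apply: filter_from_filter => // h h' Hh Hh'; exists (fun x => h x + h' x).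
      exact: HD.
    move=> x [Kx /= /eqP]; have [_ hx] := Hc _ Hh; have [_ h'x] := Hc _ Hh'.
    by rewrite paddr_eq0 // => /andP[/eqP h0 /eqP h'0].
  move=> h Hh; apply: contrapT => nB; apply: nH; exists h => // x Kx.
  rewrite lt_def; have [_ ->] := Hc _ Hh; rewrite andbT.
  by apply/eqP => hx0; apply: nB; exists x.
(* Some [h] is positive at the cluster point [x], hence near [x], yet every neighbourhood of [x]
   meets the zeros of [h]. *)
have [|x [Kx clx]] := kK _ FF.
  by have [h Hh] := H0; exists h => // x [].
have [h Hh hx] := Hpos x Kx; have [hc _] := Hc _ Hh.
have : nbhs x [set y | 0 < h y] by have /(hc x) := lt_nbhsr hx.
have : filter_from H B (B h) by exists h.
by move=> /clx/[apply] -[y [[_ /= hy] /=]]; rewrite hy ltxx.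
Qed.

End CompactDirected.

(** * Closure properties of the algebra of complex functions *)

Section ComplexFunctions.
Context {R : realType}.
Implicit Types z w : R[i].

Lemma ReD z w : complex.Re (z + w) = complex.Re z + complex.Re w.
Proof. by case: z w => ? ? []. Qed.

Lemma ImD z w : complex.Im (z + w) = complex.Im z + complex.Im w.
Proof. by case: z w => ? ? []. Qed.

Lemma ReM z w :
  complex.Re (z * w) = complex.Re z * complex.Re w - complex.Im z * complex.Im w.
Proof. by case: z w => ? ? []. Qed.

Lemma ImM z w :
  complex.Im (z * w) = complex.Re z * complex.Im w + complex.Im z * complex.Re w.
Proof. by case: z w => ? ? []. Qed.

Lemma ReN z : complex.Re (- z) = - complex.Re z.
Proof. by case: z. Qed.

Lemma ImN z : complex.Im (- z) = - complex.Im z.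
Proof. by case: z. Qed.

Lemma ReMr z (r : R) : complex.Re (z * r%:C%C) = complex.Re z * r.
Proof. by rewrite ReM /= mulr0 subr0. Qed.

Lemma ImMr z (r : R) : complex.Im (z * r%:C%C) = complex.Im z * r.
Proof. by rewrite ImM /= mulr0 add0r. Qed.

Lemma complex_neq0 z : (z != 0) = (complex.Re z != 0) || (complex.Im z != 0).
Proof. by rewrite eq_complex negb_and. Qed.

Context {k : option nat} {m : nat} {M : Ck_manifold R k m}.
Implicit Types (O K : set M) (f g : M -> R[i]).

Definition Ck_cfun_on O f : Prop :=
  Ck_fun_on O (fun x => complex.Re (f x)) /\ Ck_fun_on O (fun x => complex.Im (f x)).

Definition tsupp f : set M := closure [set x | f x != 0].

Lemma CckP f : Cck M f <-> Ck_cfun_on setT f /\ compact (tsupp f).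
Proof.
by split=> [[/Ck_fun_onT ? /Ck_fun_onT]|[[/Ck_fun_onT ? /Ck_fun_onT]]].
Qed.

Lemma Ck_cfun_on_cst O (z : R[i]) : Ck_cfun_on O (fun=> z).
Proof. by split; exact: Ck_fun_on_cst. Qed.

Lemma Ck_cfun_on_real O (h : M -> R) : Ck_fun_on O h -> Ck_cfun_on O (fun x => (h x)%:C%C).
Proof. by split => //=; exact: Ck_fun_on_cst. Qed.

Lemma Ck_cfun_on_sub O W f : O `<=` W -> Ck_cfun_on W f -> Ck_cfun_on O f.
Proof. by move=> OW [? ?]; split; exact: Ck_fun_on_sub OW _. Qed.

Lemma Ck_cfun_onM O f g : open O -> Ck_cfun_on O f -> Ck_cfun_on O g ->
  Ck_cfun_on O (fun x => f x * g x).
Proof.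
move=> oO [fR fI] [gR gI]; split.
  rewrite (_ : (fun _ => _) = (fun x => complex.Re (f x) * complex.Re (g x)
    + - (complex.Im (f x) * complex.Im (g x)))); last by apply/funext => x; rewrite ReM.
  apply: Ck_fun_onD => //; last apply: Ck_fun_onN => //; exact: Ck_fun_onM.
rewrite (_ : (fun _ => _) = (fun x => complex.Re (f x) * complex.Im (g x)
    + complex.Im (f x) * complex.Re (g x))); last by apply/funext => x; rewrite ImM.
by apply: Ck_fun_onD => //; exact: Ck_fun_onM.
Qed.

(** The factor [g] is regular only around the support of [f]; outside that support the product
    vanishes. This admits coordinates and quotients as factors. *)
Lemma Cck_mul_local O f g : open O -> tsupp f `<=` O ->
  Cck M f -> Ck_cfun_on O g -> Cck M (fun x => f x * g x).
Proof.
move=> oO fO /CckP[fC fk] gC; apply/CckP; split; last first.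
  apply: compact_closure_sub fk _; first exact: closed_closure.
  move=> x /=; rewrite mulf_eq0 negb_or => /andP[fx _]; exact: subset_closure.
have [pR pI] := Ck_cfun_onM oO (Ck_cfun_on_sub (@subsetT _ O) fC) gC.
have f0 x : ~ tsupp f x -> f x * g x = 0.
  move=> nfx; have [->|fx] := eqVneq (f x) 0; first by rewrite mul0r.
  by case: nfx; exact: subset_closure.
have cf : closed (tsupp f) := @closed_closure _ _.
by split; apply/Ck_fun_onT; apply: (Ck_fun_on_extend0 oO cf fO) => // x /f0 ->.
Qed.

Lemma CckM f g : Cck M f -> Cck M g -> Cck M (fun x => f x * g x).
Proof.
move=> fC /CckP[gC _]; apply: (@Cck_mul_local setT) => //; exact: openT.
Qed.

Lemma CckMl (z : R[i]) f : Cck M f -> Cck M (fun x => z * f x).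
Proof.
move=> fC; rewrite (_ : (fun _ => _) = fun x => f x * z).
  by apply: (@Cck_mul_local setT) => //; [exact: openT|exact: Ck_cfun_on_cst].
by apply/funext => x; rewrite mulrC.
Qed.

Lemma CckD f g : Cck M f -> Cck M g -> Cck M (fun x => f x + g x).
Proof.
move=> /CckP[[fR fI] fk] /CckP[[gR gI] gk]; apply/CckP; split.
  split; [rewrite (_ : (fun _ => _) = (fun x => complex.Re (f x) + complex.Re (g x)))
    |rewrite (_ : (fun _ => _) = (fun x => complex.Im (f x) + complex.Im (g x)))];
    try (by apply/funext => x; rewrite ?ReD ?ImD); apply: Ck_fun_onD => //; exact: openT.
have kU := compactU fk gk.
apply: compact_closure_sub kU _.
  by apply: closedU; exact: closed_closure.
move=> x /= fgx; have [f0|fx] := eqVneq (f x) 0; last by left; exact: subset_closure.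
by right; apply: subset_closure => /=; move: fgx; rewrite f0 add0r.
Qed.

Lemma CckB f g : Cck M f -> Cck M g -> Cck M (fun x => f x - g x).
Proof.
move=> fC /(CckMl (-1)) /(CckD fC); congr (Cck M _); apply/funext => x.
by rewrite mulN1r.
Qed.

Lemma Cck0 : Cck M (fun=> 0).
Proof.
apply/CckP; split; first exact: Ck_cfun_on_cst.
rewrite /tsupp (_ : [set _ | _] = set0) ?closure0; first exact: compact0.
by apply/seteqP; split=> x //=; rewrite eqxx.
Qed.

Lemma Cck_conj f : Cck M f -> Cck M (fun x => conjc (f x)).
Proof.
move=> /CckP[[fR fI] fk]; apply/CckP; split.
  split.
    by rewrite (_ : (fun _ => _) = (fun x => complex.Re (f x))) //;
      apply/funext => x; case: (f x).
  rewrite (_ : (fun _ => _) = (fun x => - complex.Im (f x))); last first.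
    by apply/funext => x; case: (f x).
  by apply: Ck_fun_onN => //; exact: openT.
rewrite (_ : tsupp _ = tsupp f) //; congr closure; apply/seteqP.
by split=> x /=; rewrite conjc_eq0.
Qed.

Lemma Cck_bump (d : chart R m M) x O : manifold_atlas d -> chart_dom d x ->
  open O -> O x -> exists chi : M -> R,
    [/\ Cck M (fun y => (chi y)%:C%C), chi x = 1,
        tsupp (fun y => (chi y)%:C%C) `<=` chart_dom d & tsupp (fun y => (chi y)%:C%C) `<=` O].
Proof.
move=> dM dx oO Ox; have [chi [cC cx ck cO]] := Ck_bump dM dx oO Ox.
exists (fun y => (chi x)^-1 * chi y).
have suppE : tsupp (fun y => ((chi x)^-1 * chi y)%:C%C) = closure [set y | chi y != 0].
  congr closure; apply/funext => y; rewrite /mkset.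
  by rewrite complex_neq0 /= eqxx orbF mulf_eq0 invr_eq0 (gt_eqF cx).
split; rewrite ?suppE.
- apply/CckP; split; last by rewrite suppE.
  apply: Ck_cfun_on_real; apply: Ck_fun_onM; first exact: openT.
    exact: Ck_fun_on_cst.
  exact/Ck_fun_onT.
- by rewrite mulVf // gt_eqF.
- by move=> y /cO[].
- by move=> y /cO[].
Qed.

End ComplexFunctions.

(** * Characters *)

Section Points.
Context {R : realType} {k : option nat} {m : nat} {M : Ck_manifold R k m}.

Lemma Cck_bump_at (x : M) O : open O -> O x ->
  exists chi : M -> R, [/\ Cck M (fun y => (chi y)%:C%C), chi x = 1 &
    forall y, chi y != 0 -> O y].
Proof.
move=> oO Ox; have [d dM dx] := manifold_cover x.
have [chi [cC cx _ cO]] := Cck_bump dM dx oO Ox; exists chi; split=> // y cy.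
by apply/cO/subset_closure; rewrite /= complex_neq0 cy.
Qed.

(** If the points differed, a bump function at [x'] supported off [x] would contradict the
    implication. *)
Lemma Cck_separates (x x' : M) :
  (forall f, Cck M f -> f x = 0 -> f x' = 0) -> x' = x.
Proof.
move=> H; apply: contrapT => xx'.
have o : open (~` [set x]).
  apply: closed_openC; apply: accessible_closed_set1.
  exact/hausdorff_accessible/manifold_hausdorff.
have [chi [cC cx' cO]] := Cck_bump_at o xx'.
have : (chi x')%:C%C = 0 :> R[i].
  apply: H cC _; have [->//|/cO] := eqVneq (chi x) 0; by case.
by rewrite cx' => /eqP; rewrite oner_eq0.
Qed.

Lemma Cck_neq0_near (f : M -> R[i]) (x : M) : Cck M f -> f x != 0 -> \near x, f x != 0.
Proof.
move=> /CckP[[fR fI] _]; rewrite complex_neq0 => /orP[fx|fx].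
  have /neq0_near/(_ fx) := @Ck_fun_on_continuous _ _ _ _ _ _ openT fR x I.
  by apply: filterS => y /= fy; rewrite complex_neq0 fy.
have /neq0_near/(_ fx) := @Ck_fun_on_continuous _ _ _ _ _ _ openT fI x I.
by apply: filterS => y /= fy; rewrite complex_neq0 fy orbT.
Qed.

Section Character.
Variable phi : (M -> R[i]) -> R[i].
Hypothesis phiD : forall f g, Cck M f -> Cck M g ->
  phi (fun x => f x + g x) = phi f + phi g.
Hypothesis phiM : forall f g, Cck M f -> Cck M g ->
  phi (fun x => f x * g x) = phi f * phi g.

Let phi0 : phi (fun=> 0) = 0.
Proof.
have := phiD Cck0 Cck0; rewrite (_ : (fun _ => _) = fun=> 0).
  by move=> /eqP; rewrite -subr_eq0 opprD addNKr oppr_eq0 => /eqP.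
by apply/funext => x; rewrite addr0.
Qed.

(* If the kernel had no common zero, finitely many of the functions |f|^2 with f
   in the kernel would add up to a function h > 0 on the support of a given g;
   then g = h (g/h) lies in the kernel. *)
Lemma character_kernel_zero (g : M -> R[i]) : Cck M g -> phi g != 0 ->
  exists x, forall f, Cck M f -> phi f = 0 -> f x = 0.
Proof.
move=> gC g0; apply: contrapT => nx; case/negP: g0.
pose H := [set h : M -> R | [/\ Cck M (fun x => (h x)%:C%C),
  phi (fun x => (h x)%:C%C) = 0 & forall x, 0 <= h x]].
have Hcont h : H h -> continuous h.
  move=> [/CckP[[hR _] _] _ _] x.
  exact: (@Ck_fun_on_continuous _ _ _ _ _ _ openT hR x I).
have [_ gk] := (CckP g).1 gC.
have [|||x gx|h Hh hpos] := @compact_directed_gt0 _ _ (tsupp g) H gk.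
- by exists (fun=> 0); split => //; exact: Cck0.
- by move=> h Hh; split; [exact: Hcont|case: Hh].
- move=> h h' [hC h0 hp] [h'C h'0 h'p].
  have E : (fun x => (h x + h' x)%:C%C) = (fun x => (h x)%:C%C + (h' x)%:C%C : R[i]).
    by apply/funext => x; rewrite rmorphD.
  split; rewrite ?E; first exact: CckD.
    by rewrite phiD // h0 h'0 addr0.
  by move=> x; rewrite addr_ge0.
- have /existsNP[f /not_implyP[fC /not_implyP[f0 fx]]] :
      ~ forall f, Cck M f -> phi f = 0 -> f x = 0.
    by move=> Hx; apply: nx; exists x.
  (* [|f|^2] is [f] times its conjugate, so it lies in the kernel together with [f], whatever [phi]
     does to conjugates. *)
  pose h x := complex.Re (f x) ^+ 2 + complex.Im (f x) ^+ 2.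
  have E : (fun x => (h x)%:C%C) = (fun x => f x * conjc (f x)).
    apply/funext => z; rewrite /h; case: (f z) => a b /=.
    by apply/eqP; rewrite eq_complex /=; apply/andP; split; apply/eqP; ring.
  exists h; last first.
    rewrite /h lt_def paddr_eq0 ?sqr_ge0 // !sqrf_eq0 addr_ge0 ?sqr_ge0 // andbT.
    by rewrite negb_and -complex_neq0; exact/eqP.
  split; rewrite ?E; [|rewrite phiM ?f0 ?mul0r //|by move=> z; rewrite addr_ge0 ?sqr_ge0].
    by apply: CckM => //; exact: Cck_conj.
  exact: Cck_conj.
have [hC h0 _] := Hh.
pose O := [set x | h x != 0].
have oO : open O.
  by apply: (@open_comp _ _ h [set r | r != 0]); [move=> x _; exact: Hcont|exact: open_neq].
have gO : tsupp g `<=` O by move=> x /hpos; rewrite /O /= lt_def => /andP[].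
have qC : Cck M (fun x => g x * ((h x)^-1)%:C%C).
  apply: (Cck_mul_local oO gO gC); apply: Ck_cfun_on_real; apply: Ck_fun_onV => //.
  by have /CckP[[hR _] _] := hC; apply: Ck_fun_on_sub hR.
suff -> : g = fun x => (h x)%:C%C * (g x * ((h x)^-1)%:C%C).
  by rewrite phiM // h0 mul0r eqxx.
apply/funext => x; have [->|gx] := eqVneq (g x) 0; first by rewrite mul0r mulr0.
have hx : h x != 0 by apply: gO; exact: subset_closure.
by rewrite mulrCA -rmorphM mulfV // mulr1.
Qed.

(** For the converse, suppose [f x = 0] and [phi f] is nonzero, and pick [f'] with [phi (f f') = 1].
    Then [chi - chi f f'] is in the kernel, but its value at [x] is 1. The bump function [chi]
    stands in for a unit of the algebra. *)
Lemma character_point (g : M -> R[i]) : Cck M g -> phi g != 0 ->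
  (forall z, exists2 f, Cck M f & phi f = z) ->
  exists x, forall f, Cck M f -> (phi f = 0 <-> f x = 0).
Proof.
move=> gC g0 phi_surj; have [x Hx] := character_kernel_zero gC g0.
exists x => f fC; split; first exact: Hx.
move=> fx; apply/eqP; apply/negPn/negP => pf.
have [f' f'C f'E] := phi_surj (phi f)^-1.
have ffC := CckM fC f'C.
have [chi [cC cx _]] := @Cck_bump_at x setT openT I.
have cfC := CckM cC ffC.
have : (chi x)%:C%C - (chi x)%:C%C * (f x * f' x) = 0 :> R[i].
  apply: (Hx (fun x => (chi x)%:C%C - (chi x)%:C%C * (f x * f' x))); first exact: CckB.
  (* Additivity is used on the sum [(chi - chi f f') + chi f f' = chi], whose last two terms have
     the same image. *)
  have e := phiD (CckB cC cfC) cfC.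
  move: e; rewrite (_ : (fun _ => _) = (fun y => (chi y)%:C%C)); last first.
    by apply/funext => y; rewrite subrK.
  rewrite [X in _ = _ + X]phiM // phiM // f'E mulfV // mulr1.
  by move=> /eqP; rewrite eq_sym -subr_eq0 addrK => /eqP.
by rewrite fx mul0r mulr0 subr0 cx => /eqP; rewrite oner_eq0.
Qed.

End Character.

End Points.

(** * The point map and the field automorphisms *)

Lemma additive_multiplicative_ratr (R : realType) (tau : R[i] -> R[i]) (q : rat) :
  {morph tau : x y / x + y} -> {morph tau : x y / x * y} -> tau 1 = 1 ->
  tau (ratr q : R)%:C%C = (ratr q : R)%:C%C.
Proof.
move=> tauD tauM tau1.
have tau0 : tau 0 = 0 by apply: (addIr (tau 0)); rewrite -tauD !add0r.
have tauN x : tau (- x) = - tau x.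
  by apply: (addIr (tau x)); rewrite -tauD !addNr.
have taun n : tau n%:R = n%:R.
  by elim: n => // n IH; rewrite -addn1 !natrD tauD IH tau1.
have tauz (z : int) : tau z%:~R = z%:~R.
  case: z => n; first exact: taun.
  by rewrite NegzE mulrNz tauN; congr (- _); exact: taun.
rewrite !fmorph_rat.
have d0 : (denq q)%:~R != 0 :> R[i] by rewrite intr_eq0 denq_neq0.
by apply: (mulIf d0); rewrite -{1}(tauz (denq q)) -tauM /ratr divfK // tauz.
Qed.

(** A nonzero value at 0 would persist on a ball, while some [c + t] with [t] in that ball is
    rational. *)
Lemma eq0_of_rational_zeros (R : realType) (h : R -> R) (c : R) :
  {for 0, continuous h} ->
  (\forall t \near (0 : R), forall q : rat, c + t = ratr q -> h t = 0) -> h 0 = 0.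
Proof.
move=> hc hq; apply/eqP/negPn/negP => h0.
have /nbhs_ballP[r /= r0 rH] : nbhs (0 : R)
    ([set t | forall q : rat, c + t = ratr q -> h t = 0] `&` [set t | h t != 0]).
  by apply: filterI; [exact: hq|exact: neq0_near hc h0].
have [||z [/= zc [q _ qz]]] := @dense_rat R `]c, c + r[%classic.
- by exists (c + r / 2); rewrite /= in_itv /= ; move: r0; lra.
- exact: interval_open.
have [|hz] := rH (z - c).
  by rewrite /ball /= sub0r normrN ger0_norm; move: zc; rewrite in_itv /=; lra.
by rewrite /= (hz q) ?eqxx // qz addrC subrK.
Qed.

Section Isomorphism.
Context {R : realType} {k : option nat} {m n : nat}.

Lemma Cck_isomorphism_inv (M : Ck_manifold R k m) (N : Ck_manifold R k n) T :
  @Cck_isomorphism R k m n M N T ->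
  exists T', [/\ @Cck_isomorphism R k n m N M T',
    forall f, Cck M f -> T' (T f) = f & forall g, Cck N g -> T (T' g) = g].
Proof.
move=> [[Tfun Tinj Tsurj] TD TM].
(* Outside [Cck N] the set is empty and the value is the default zero function. *)
pose T' g := xget (fun=> 0) [set f | Cck M f /\ T f = g].
have T'P g : Cck N g -> Cck M (T' g) /\ T (T' g) = g.
  by move=> /Tsurj[f fC fg]; apply: (@xgetPex _ _ [set f | Cck M f /\ T f = g]); exists f.
have TI f f' : Cck M f -> Cck M f' -> T f = T f' -> f = f'.
  by move=> fC f'C; apply: Tinj; rewrite inE.
have T'K f : Cck M f -> T' (T f) = f.
  by move=> fC; have [? ?] := T'P _ (Tfun _ fC); exact: TI.
have T'C g : Cck N g -> Cck M (T' g) by move=> /T'P[].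
have TK g : Cck N g -> T (T' g) = g by move=> /T'P[].
exists T'; split=> //; split.
- split=> //; last by move=> f fC; exists (T f); [exact: Tfun|exact: T'K].
  by move=> g g'; rewrite !inE => gC g'C gg'; rewrite -(TK g) // gg' TK.
- move=> f g fC gC; apply: TI; [exact/T'C/CckD|apply: CckD; exact: T'C|].
  by rewrite TK ?TD ?TK //; [exact: T'C|exact: T'C|exact: CckD].
- move=> f g fC gC; apply: TI; [exact/T'C/CckM|apply: CckM; exact: T'C|].
  by rewrite TK ?TM ?TK //; [exact: T'C|exact: T'C|exact: CckM].
Qed.

Lemma Cck_isomorphism_point (M : Ck_manifold R k m) (N : Ck_manifold R k n) T :
  @Cck_isomorphism R k m n M N T ->
  exists psi : N -> M, forall y f, Cck M f -> (T f y = 0 <-> f (psi y) = 0).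
Proof.
move=> [[Tfun _ Tsurj] TD TM].
suff : forall y : N, exists x : M, forall f, Cck M f -> (T f y = 0 <-> f x = 0).
  by move=> H; have [psi psiP] := choice H; exists psi.
(* The multiples [z * chi] take every value at [y], so evaluating [T f] at [y] is onto the complex
   numbers. *)
move=> y; have [chi [cC cy _]] := @Cck_bump_at _ _ _ N y setT openT I.
have [g gC gE] := Tsurj _ cC.
apply: (@character_point _ _ _ M (fun f => T f y) _ _ g) => //.
- by move=> f f' fC f'C; rewrite TD.
- by move=> f f' fC f'C; rewrite TM.
- by rewrite gE cy oner_eq0.
- move=> z; have [f fC fE] := Tsurj _ (CckMl z cC).
  by exists f => //; rewrite fE cy mulr1.
Qed.

End Isomorphism.

(** * The point map: a criterion for class C^k, continuity, and the induced maps on values *)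

Section PointMap.
Context {R : realType} {k : option nat} {m n : nat}.
Variables (M : Ck_manifold R k m) (N : Ck_manifold R k n).

(** A coordinate is not compactly supported, but [chi] times it is, and so is [chi]. Both pull back
    to C^k functions, and dividing recovers the coordinate of [psi] where [chi \o psi] is
    nonzero. *)
Lemma Ck_map_pullback (psi : N -> M) : continuous psi ->
  (forall f : M -> R, Cck M (fun x => (f x)%:C%C) -> Ck_real_fun (f \o psi)) ->
  Ck_map psi.
Proof.
move=> psic pull; split=> // c d cN dM.
have od : open (psi @^-1` chart_dom d).
  by apply: open_comp => [y _|]; [exact: psic|exact: chart_dom_open].
apply/Ck_on_rV; first exact: open_image_chart.
move=> j; suff : Ck_fun_on (psi @^-1` chart_dom d) (fun y => chart_map d (psi y) 0 j).
  by move=> /(_ c cN).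
apply: Ck_fun_on_local => y dy.
have [chi [cC cy cd _]] := Cck_bump dM dy (@openT M) I.
have /Ck_fun_onT chiC := pull _ cC.
have /Ck_fun_onT coordC : Ck_real_fun ((fun x => chi x * chart_map d x 0 j) \o psi).
  apply: pull.
  rewrite (_ : (fun _ => _) = fun x => (chi x)%:C%C * (chart_map d x 0 j)%:C%C); last first.
    by apply/funext => x; rewrite rmorphM.
  apply: (Cck_mul_local (chart_dom_open d)) => //.
  by apply: Ck_cfun_on_real; exact: Ck_fun_on_coord.
pose W := [set z | chi (psi z) != 0].
have oW : open W.
  rewrite openE => z Wz; apply: neq0_near Wz.
  exact: (@Ck_fun_on_continuous _ _ _ _ _ (chi \o psi) openT chiC z I).
exists W; first by rewrite /W /= cy oner_neq0.
apply: (@Ck_fun_on_eq _ _ _ _ _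
  (fun z => (chi (psi z) * chart_map d (psi z) 0 j) * (chi (psi z))^-1)) => //.
  by move=> z Wz; rewrite mulrAC mulfV // mul1r.
apply: Ck_fun_onM => //; first exact: Ck_fun_on_sub coordC.
by apply: Ck_fun_onV => //; exact: Ck_fun_on_sub chiC.
Qed.

Variable T : (M -> R[i]) -> (N -> R[i]).
Hypothesis T_iso : Cck_isomorphism T.
Variable psi : N -> M.
Hypothesis psiP : forall y f, Cck M f -> (T f y = 0 <-> f (psi y) = 0).

Let TC f : Cck M f -> Cck N (T f).
Proof. by have [[+ _ _] _ _] := T_iso; apply. Qed.

(** The preimage under [psi] of the nonvanishing set of a bump function [chi] is the nonvanishing
    set of [T chi], which is open. *)
Lemma point_map_continuous : continuous psi.
Proof.
move=> y A; rewrite nbhsE => -[U [oU Uy] UA].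
have [chi [cC cy cO]] := Cck_bump_at oU Uy.
have psi_neq0 z : (T (fun x => (chi x)%:C%C) z != 0) = (chi (psi z) != 0).
  congr (~~ _); apply/eqP/eqP => [/(psiP _ cC)|chi0]; first by case.
  by apply/(psiP _ cC); rewrite chi0.
have : T (fun x => (chi x)%:C%C) y != 0 by rewrite psi_neq0 cy oner_neq0.
move=> /(Cck_neq0_near (TC cC)); apply: filterS => z.
by rewrite psi_neq0 => /cO/UA.
Qed.

Lemma point_value_eq y f g : Cck M f -> Cck M g -> f (psi y) = g (psi y) -> T f y = T g y.
Proof.
move=> fC gC fg; have [_ TD _] := T_iso.
have fgC := CckB fC gC.
have : T (fun x => f x - g x) y = 0 by apply/psiP => //; rewrite fg subrr.
have -> : T f = T (fun x => (f x - g x) + g x).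
  by congr T; apply/funext => x; rewrite subrK.
by rewrite (TD (fun x => f x - g x)) // => ->; rewrite add0r.
Qed.

(** Take [tau z = T (z * chi) y] with [chi (psi y) = 1]. By [point_value_eq] any other function with
    value [z] at [psi y] gives the same result. *)
Lemma point_value_automorphism (y : N) : exists tau : R[i] -> R[i],
  [/\ forall f, Cck M f -> T f y = tau (f (psi y)), {morph tau : a b / a + b},
      {morph tau : a b / a * b} & tau 1 = 1].
Proof.
have [_ TD TM] := T_iso.
have [chi [cC cx _]] := @Cck_bump_at _ _ _ M (psi y) setT openT I.
have zC z := CckMl z cC.
exists (fun z => T (fun x => z * (chi x)%:C%C) y); split.
- by move=> f fC; apply: point_value_eq => //; rewrite cx mulr1.
- move=> a b; rewrite -[RHS]/((fun y => _ + _) y) -TD //; congr (T _ y).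
  by apply/funext => x; rewrite mulrDl.
- move=> a b; rewrite -[RHS]/((fun y => _ * _) y) -TM //.
  by apply: point_value_eq => //; [exact: CckM|rewrite cx !mulr1].
(* [tau 1] is idempotent and nonzero, hence 1. *)
- have T0 : T (fun x => 1 * (chi x)%:C%C) y != 0.
    by apply/eqP => /(psiP _ (zC 1)); rewrite cx mulr1 => /eqP; rewrite oner_eq0.
  apply: (mulfI T0); rewrite mulr1 -[LHS]/((fun y => _ * _) y) -TM //.
  by apply: point_value_eq => //; [exact: CckM|rewrite cx !mulr1].
Qed.

End PointMap.

(** * The field automorphisms are the identity or the conjugation *)

Section Automorphisms.
Context {R : realType} {k : option nat} {m n : nat}.
Variables (M : Ck_manifold R k m) (N : Ck_manifold R k n).
Variables (T : (M -> R[i]) -> (N -> R[i])) (psi : N -> M) (psi' : M -> N).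
Variable tau : N -> R[i] -> R[i].
Hypothesis TC : forall f, Cck M f -> Cck N (T f).
Hypothesis psiK' : cancel psi' psi.
Hypothesis psi'_continuous : continuous psi'.
Hypothesis T_tau : forall y f, Cck M f -> T f y = tau y (f (psi y)).
Hypothesis tauD : forall y, {morph tau y : a b / a + b}.
Hypothesis tauM : forall y, {morph tau y : a b / a * b}.
Hypothesis tau1 : forall y, tau y 1 = 1.

Let T_pullback_continuous f : Cck M f ->
  continuous (fun x => complex.Re (T f (psi' x))) /\
  continuous (fun x => complex.Im (T f (psi' x))).
Proof.
move=> /TC/CckP[[fR fI] _]; split=> x.
  apply: (@continuous_comp _ _ _ psi' (fun y => complex.Re (T f y))).
    exact: psi'_continuous.
  exact: (@Ck_fun_on_continuous _ _ _ _ _ _ openT fR (psi' x) I).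
apply: (@continuous_comp _ _ _ psi' (fun y => complex.Im (T f y))).
  exact: psi'_continuous.
exact: (@Ck_fun_on_continuous _ _ _ _ _ _ openT fI (psi' x) I).
Qed.

(* Near a point x0 with first coordinate a the function c + (x_1 - a) takes
   rational values, which every automorphism fixes, on a set accumulating at
   x0; the continuity of its image then determines tau c. *)
Lemma tau_real (m_gt0 : (0 < m)%N) x0 c : tau (psi' x0) c%:C%C = c%:C%C.
Proof.
have [d dM dx0] := manifold_cover x0.
have [chi [cC cx0 cd _]] := Cck_bump dM dx0 (@openT M) I.
pose j := Ordinal m_gt0; pose a := chart_map d x0.
pose w x := c + (chart_map d x 0 j - a 0 j).
have od := chart_dom_open d.
have fC : Cck M (fun x => (chi x)%:C%C * (w x)%:C%C).
  apply: (Cck_mul_local od) => //; apply: Ck_cfun_on_real.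
  apply: Ck_fun_onD => //; first exact: Ck_fun_on_cst.
  by apply: Ck_fun_onD => //; [exact: Ck_fun_on_coord|exact: Ck_fun_on_cst].
(* Along this line [w] equals [c + t], as long as the line stays in the chart image. *)
pose line (t : R) : 'rV[R]_m := a + t *: delta_mx 0 j.
pose gam t := chart_inv d (line t).
have gam0 : gam 0 = x0 by rewrite /gam /line scale0r addr0 chart_mapK.
have line_continuous : {for 0, continuous line}.
  by apply: cvgD; [exact: cvg_cst|apply: cvgZl; exact: cvg_id].
have line0 : chart_im d (line 0) by rewrite /line scale0r addr0; exists x0.
have gamc : {for 0, continuous gam}.
  by apply: continuous_comp => //; exact: chart_inv_continuous.
have near_im : \forall t \near (0 : R), chart_im d (line t).
  apply: line_continuous; apply: open_nbhs_nbhs; split=> //; exact: chart_im_open.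
have gamw t : chart_im d (line t) -> w (gam t) = c + t.
  move=> dt; rewrite /w /gam chart_invK // /line !mxE !eqxx mulr1.
  by rewrite addrAC subrr add0r.
(* For small [t] this is [tau (chi) * (tau (c + t) - (c + t))] at the point [gam t]. It is
   continuous at 0 and vanishes when [c + t] is rational; at [t = 0] the factor [tau (chi)] is 1. *)
pose E t := T (fun x => (chi x)%:C%C * (w x)%:C%C) (psi' (gam t))
  - T (fun x => (chi x)%:C%C) (psi' (gam t)) * (c + t)%:C%C.
have Erat : \forall t \near (0 : R), forall q : rat, c + t = ratr q -> E t = 0.
  apply: filterS near_im => t dt q ctq.
  rewrite /E !T_tau // psiK' tauM gamw // ctq additive_multiplicative_ratr //.
  by rewrite subrr.
have ctc : {for 0, continuous (fun t => c + t)}.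
  by apply: continuousD; [exact: cst_continuous|exact: cvg_id].
have along (h : M -> R) : continuous h -> {for 0, continuous (h \o gam)}.
  by move=> hc; apply: continuous_comp => //; exact: hc.
have [fR fI] := T_pullback_continuous fC.
have [chiR chiI] := T_pullback_continuous cC.
have ReE0 : complex.Re (E 0) = 0.
  apply: (@eq0_of_rational_zeros _ (fun t => complex.Re (E t)) c); last first.
    by apply: filterS Erat => t Et q /Et ->.
  rewrite (_ : (fun t => _) = ((fun x =>
    complex.Re (T (fun x => (chi x)%:C%C * (w x)%:C%C) (psi' x))) \o gam) -
    ((fun x => complex.Re (T (fun x => (chi x)%:C%C) (psi' x))) \o gam) * (fun t => c + t)).
    by apply: continuousB; [exact: along|apply: continuousM => //; exact: along].
  by apply/funext => t; rewrite /E ReD ReN ReMr.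
have ImE0 : complex.Im (E 0) = 0.
  apply: (@eq0_of_rational_zeros _ (fun t => complex.Im (E t)) c); last first.
    by apply: filterS Erat => t Et q /Et ->.
  rewrite (_ : (fun t => _) = ((fun x =>
    complex.Im (T (fun x => (chi x)%:C%C * (w x)%:C%C) (psi' x))) \o gam) -
    ((fun x => complex.Im (T (fun x => (chi x)%:C%C) (psi' x))) \o gam) * (fun t => c + t)).
    by apply: continuousB; [exact: along|apply: continuousM => //; exact: along].
  by apply/funext => t; rewrite /E ImD ImN ImMr.
have : E 0 = 0 by apply/eqP; rewrite eq_complex ReE0 ImE0 !eqxx.
rewrite /E gam0 !T_tau // psiK' cx0 tau1 mul1r addr0 /w subrr addr0 mul1r.
by move/eqP; rewrite subr_eq0 => /eqP.
Qed.

Lemma tau_i y : tau y 'i%C = 'i%C \/ tau y 'i%C = - 'i%C.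
Proof.
have : tau y 'i%C ^+ 2 = 'i%C ^+ 2.
  rewrite expr2 -tauM -expr2 sqr_i.
  apply: (addrI 1); rewrite subrr -{1}(tau1 y) -tauD subrr.
  by apply: (addrI (tau y 0)); rewrite -tauD !addr0.
by move/eqP; rewrite eqf_sqr => /orP[/eqP|/eqP]; [left|right].
Qed.

(** By [tau_real] and [tau_i], the imaginary part of [T (i chi)] at [psi' x] is [chi x] or its
    opposite. It is continuous, so its sign is constant near [x0], where [chi] is positive. *)
Lemma tau_i_near (m_gt0 : (0 < m)%N) x0 :
  \forall x \near x0, tau (psi' x) 'i%C = tau (psi' x0) 'i%C.
Proof.
have [chi [cC cx0 _]] := @Cck_bump_at _ _ _ M x0 setT openT I.
have iC := CckMl 'i%C cC.
have [_ sc] := T_pullback_continuous iC.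
have TE x : T (fun x => 'i%C * (chi x)%:C%C) (psi' x) = tau (psi' x) 'i%C * (chi x)%:C%C.
  by rewrite T_tau // tauM psiK' tau_real.
have chi_gt0 : \forall x \near x0, 0 < chi x.
  have /CckP[[cR _] _] := cC.
  apply: (@Ck_fun_on_continuous _ _ _ _ _ _ openT cR x0 I [set r | 0 < r]).
  by apply: lt_nbhsr; rewrite /= cx0.
have ImTE x : complex.Im (tau (psi' x) 'i%C * (chi x)%:C%C) =
    complex.Im (tau (psi' x) 'i%C) * chi x by rewrite ImMr.
have [ti|ti] := tau_i (psi' x0).
  have : \forall x \near x0, 0 < complex.Im (T (fun x => 'i%C * (chi x)%:C%C) (psi' x)).
    by apply: (sc x0 [set r | 0 < r]); apply: lt_nbhsr; rewrite TE ImTE ti cx0 /= mulr1.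
  apply: filterS2 chi_gt0 => x cx; rewrite TE ImTE ti.
  by have [->//|->] := tau_i (psi' x); rewrite /= mulN1r oppr_gt0 ltNge (ltW cx).
have : \forall x \near x0, complex.Im (T (fun x => 'i%C * (chi x)%:C%C) (psi' x)) < 0.
  by apply: (sc x0 [set r | r < 0]); apply: lt_nbhsl; rewrite TE ImTE ti cx0 /= mulr1 oppr_lt0.
apply: filterS2 chi_gt0 => x cx; rewrite TE ImTE ti.
by have [->|->//] := tau_i (psi' x); rewrite /= mul1r ltNge (ltW cx).
Qed.

Lemma T_pullback_or_conj (m_gt0 : (0 < m)%N) : connected [set: M] -> cancel psi psi' ->
  (forall f, Cck M f -> T f = (fun y => f (psi y))) \/
  (forall f, Cck M f -> T f = (fun y => conjc (f (psi y)))).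
Proof.
move=> Mconn psiK.
(* By [tau_i_near] this set is open and closed, so connectedness leaves the empty set (conjugation)
   or everything (identity). *)
pose A := [set x | tau (psi' x) 'i%C = 'i%C].
have oA : open A.
  by rewrite openE => x Ax; apply: filterS (tau_i_near m_gt0 x) => z tz; rewrite /A /= tz.
have cA : closed A.
  rewrite -openC openE => x Ax; apply: filterS (tau_i_near m_gt0 x) => z Ez Az.
  by apply: Ax; rewrite /A /= -Ez.
have tau_r y r : tau y r%:C%C = r%:C%C by rewrite -[y]psiK tau_real.
have tauE y z : tau y z = (complex.Re z)%:C%C + tau y 'i%C * (complex.Im z)%:C%C.
  by rewrite {1}[z]complexE tauD tauM !tau_r.
have [A0|/set0P An0] := eqVneq A set0.
  right => f fC; apply/funext => y; rewrite T_tau // tauE.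
  have [ti|->] := tau_i y; first by have : A (psi y); [rewrite /A /= psiK|rewrite A0].
  by case: (f (psi y)) => r s; apply/eqP; rewrite eq_complex /=; apply/andP; split; apply/eqP; ring.
left => f fC; apply/funext => y; rewrite T_tau // tauE.
have : A (psi y).
  rewrite (Mconn A) //; [by exists A => //; rewrite setTI|by exists A => //; rewrite setTI].
rewrite /A /= psiK => ->.
by case: (f (psi y)) => r s; apply/eqP; rewrite eq_complex /=; apply/andP; split; apply/eqP; ring.
Qed.

End Automorphisms.

(** * The point maps of [T] and of its inverse are mutually inverse diffeomorphisms *)

Theorem corollary1p9 (R : realType) (k : option nat) (m n : nat)
    (M : Ck_manifold R k m) (N : Ck_manifold R k n)
    (m_gt0 : (0 < m)%N) (M_connected : connected [set: M])
    (T : (M -> R[i]) -> (N -> R[i])) (T_iso : Cck_isomorphism T) :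
  exists psi : N -> M,
    Ck_diffeomorphism psi /\
    ((forall f, Cck M f -> T f = (fun y => f (psi y))) \/
     (forall f, Cck M f -> T f = (fun y => conjc (f (psi y))))).
Proof.
have [T' [T'_iso T'K TK]] := Cck_isomorphism_inv T_iso.
have [psi psiP] := Cck_isomorphism_point T_iso.
have [psi' psi'P] := Cck_isomorphism_point T'_iso.
have TC f : Cck M f -> Cck N (T f) by have [[+ _ _] _ _] := T_iso; apply.
have T'C g : Cck N g -> Cck M (T' g) by have [[+ _ _] _ _] := T'_iso; apply.
have psiK' : cancel psi' psi.
  (* Vanishing of [f = T' (T f)] at [x], of [T f] at [psi' x], and of [f] at [psi (psi' x)] are
     equivalent. *)
  move=> x; apply: Cck_separates => f fC fx.
  by apply/(psiP _ f fC)/(psi'P _ _ (TC f fC)); rewrite T'K.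
have psiK : cancel psi psi'.
  move=> y; apply: Cck_separates => g gC gy.
  by apply/(psi'P _ g gC)/(psiP _ _ (T'C g gC)); rewrite TK.
have psi_continuous := point_map_continuous T_iso psiP.
have psi'_continuous := point_map_continuous T'_iso psi'P.
have [tau tauP] := choice (point_value_automorphism T_iso psiP).
have Tpsi : (forall f, Cck M f -> T f = (fun y => f (psi y))) \/
     (forall f, Cck M f -> T f = (fun y => conjc (f (psi y)))).
  apply: (@T_pullback_or_conj _ _ _ _ M N T psi psi' tau) => //.
  - by move=> y f; have [+ _ _ _] := tauP y; apply.
  - by move=> y; have [] := tauP y.
  - by move=> y; have [] := tauP y.
  - by move=> y; have [] := tauP y.
exists psi; split=> //; split.
  apply: Ck_map_pullback => // f fC.
  (* For real [f] both forms of [T] give [T f] the real part [f \o psi]. *)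
  have /CckP[[/Ck_fun_onT + _] _] := TC _ fC.
  congr Ck_real_fun; apply/funext => y.
  by case: Tpsi => ->.
exists psi'; split=> //; apply: Ck_map_pullback => // g gC.
have /CckP[[/Ck_fun_onT + _] _] := T'C _ gC.
congr Ck_real_fun; apply/funext => x /=.
(* The form of [T] is known but not that of [T']: applying [T] to [T' g] leaves the real part at [x]
   unchanged in both cases. *)
have <- : complex.Re (T (T' (fun y => (g y)%:C%C)) (psi' x)) = g (psi' x) by rewrite TK.
by case: Tpsi => H; rewrite (H _ (T'C _ gC)) psiK' //; case: (T' _ x).
Qed.
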